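(* Let $\Gamma=\langle\mathcal{A},\mathcal{R}\rangle$ be an AFRA. The set of all admissible sets of $\Gamma$ forms a complete partial order with respect to set inclusion.
   Context: An AFRA (Argumentation Framework with Recursive Attacks) is a pair $\langle\mathcal{A},\mathcal{R}\rangle$ where $\mathcal{A}$ is a set (of arguments) and $\mathcal{R}$ is a set of attacks, each attack being a pair $\alpha=(A,X)$ with $A\in\mathcal{A}$ and ($X\in\mathcal{R}$ or $X\in\mathcal{A}$); $A=src(\alpha)$ is its source and $X=trg(\alpha)$ its target. Arguments and attacks are distinct objects ($\mathcal{A}\cap\mathcal{R}=\emptyset$). Defeat: for $\alpha\in\mathcal{R}$, $V\in\mathcal{A}\cup\mathcal{R}$, $\alpha$ directly defeats $V$ iff $V=trg(\alpha)$; $\alpha$ indirectly defeats $\beta\in\mathcal{R}$ iff $\alpha$ directly defeats $src(\beta)$; $\alpha\rightarrow_R V$ ($\alpha$ defeats $V$) iff $\alpha$ directly or indirectly defeats $V$. Only attacks can defeat. A set $\mathcal{S}\subseteq\mathcal{A}\cup\mathcal{R}$ is conflict-free iff there are no $V,W\in\mathcal{S}$ with $V\rightarrow_R W$. $W\in\mathcal{A}\cup\mathcal{R}$ is acceptable w.r.t. $\mathcal{S}$ iff for every $\alpha\in\mathcal{R}$ with $\alpha\rightarrow_R W$ there is $\beta\in\mathcal{S}$ with $\beta\rightarrow_R\alpha$. $\mathcal{S}$ is admissible iff it is conflict-free and each of its elements is acceptable w.r.t. $\mathcal{S}$. A partially ordered set is a complete partial order if (i) it has a least element and (ii) each chain in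 it has a least upper bound in it. *)

(* Defs.v *)
From HB Require Import structures.
From mathcomp Require Import all_boot all_order.
From mathcomp Require Import boolp classical_sets.

Set Implicit Arguments.
Unset Strict Implicit.
Unset Printing Implicit Defensive.

Import Order.TTheory.

Local Open Scope classical_set_scope.

(* Attacks are literally pairs (source, target), so an attack is determined by
   its source and target; as with set-theoretic pairs under foundation, chains
   of attacks on attacks are well-founded.  The two constructors keep arguments
   and attacks disjoint.  Arguments are drawn from an arbitrary type U. *)
Inductive entity (U : Type) : Type :=
| Arg of U
| Att of U * entity U.

Definition attack (U : Type) : Type := (U * entity U)%type.

Definition src (U : Type) (a : attack U) : U := a.1.
Definition trg (U : Type) (a : attack U) : entity U := a.2.

Record afra (U : Type) := Afra {
  arguments : set U;
  attacks : set (attack U);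
  src_arguments : forall a, attacks a -> arguments (src a);
  trg_entities : forall a, attacks a ->
    (exists2 b, attacks b & trg a = Att b) \/
    (exists2 A, arguments A & trg a = Arg A) }.

Section Semantics.
Variables (U : Type) (G : afra U).
Implicit Types (a b : attack U) (V W : entity U) (S : set (entity U)).

Definition entities : set (entity U) :=
  (@Arg U @` arguments G) `|` (@Att U @` attacks G).

Definition directly_defeats a V : Prop := V = trg a.

Definition indirectly_defeats a V : Prop :=
  exists2 b, attacks G b & V = Att b /\ directly_defeats a (Arg (src b)).

Definition defeats V W : Prop :=
  exists a, [/\ attacks G a, V = Att a, entities W
              & directly_defeats a W \/ indirectly_defeats a W].

Definition conflict_free S : Prop :=
  ~ exists V W, [/\ S V, S W & defeats V W].

Definition acceptable S W : Prop :=
  forall a, attacks G a -> defeats (Att a) W ->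
    exists2 V, S V & defeats V (Att a).

Definition admissible : set (set (entity U)) :=
  [set S | [/\ S `<=` entities, conflict_free S
             & forall W, S W -> acceptable S W]].

End Semantics.

(* On set T, the order <= of the library is set inclusion (lemma subsetEset);
   the last instance below restricts it to the admissible sets. *)
Record admissible_set (U : Type) (G : afra U) := AdmissibleSet {
  aset :> set (entity U);
  asetP : aset \in admissible G }.

HB.instance Definition _ (U : Type) (G : afra U) := [isSub for @aset U G].
HB.instance Definition _ (U : Type) (G : afra U) :=
  [Choice of admissible_set G by <:].
HB.instance Definition _ (U : Type) (G : afra U) :=
  [SubChoice_isSubPOrder of admissible_set G by <: with set_display].

(* The empty chain is allowed: its least upper bound is the least element. *)
Definition complete_partial_order (d : Order.disp_t) (T : porderType d) : Prop :=
  (exists x : T, forall y : T, (x <= y)%O) /\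
  (forall C : set T, total_on C (fun x y => (x <= y)%O) ->
     exists x : T, supremums C x).

(* Main.v *)
Require Import Defs.
From HB Require Import structures.
From mathcomp Require Import all_boot all_order.
From mathcomp Require Import boolp classical_sets.

(* The union of a chain of admissible sets is admissible: two elements of the
   union already lie together in one member of the chain, so the union is
   conflict-free, and acceptability is monotone in the defending set. *)

Local Open Scope classical_set_scope.

Lemma acceptableS (U : Type) (G : afra U) (S S' : set (entity U))
    (W : entity U) :
  S `<=` S' -> acceptable G S W -> acceptable G S' W.
Proof.
move=> sSS' accW a Ra aW; have [V SV Va] := accW a Ra aW.
by exists V => //; apply: sSS'.
Qed.

(** Stated for an indexed family so that [F] can be the projection [aset] and [C] a chain in the
    subtype itself. *)
Lemma admissible_bigcup (U I : Type) (G : afra U) (C : set I)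
    (F : I -> set (entity U)) :
  (forall i, C i -> admissible G (F i)) ->
  total_on C (fun i j => F i `<=` F j) ->
  admissible G (\bigcup_(i in C) F i).
Proof.
move=> admF totF; split.
- by move=> V [i Ci FiV]; have [+ _ _] := admF i Ci; apply.
- move=> [V [W [[i Ci FiV] [j Cj FjW] VW]]].
  case: (totF i j Ci Cj) => sF.
  + by have [_ + _] := admF j Cj; apply; exists V, W; split=> //; apply: sF.
  + by have [_ + _] := admF i Ci; apply; exists V, W; split=> //; apply: sF.
- move=> W [i Ci FiW]; apply: (@acceptableS _ _ (F i)).
    exact: bigcup_sup.
  by have [_ _ +] := admF i Ci; apply.
Qed.

(** The subtype inherits its order along [aset]; this bridge lets facts about unions of sets serve
    as facts about suprema. *)
Lemma le_admissible_set (U : Type) (G : afra U) (S S' : admissible_set G) :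
  (S <= S')%O <-> aset S `<=` aset S'.
Proof.
by rewrite -Order.le_val; split=> [/subsetPset|/subsetPset].
Qed.

Theorem theorem1 (U : Type) (G : afra U) :
  complete_partial_order (admissible_set G).
Proof.
have sup_chain (C : set (admissible_set G)) :
    total_on C (fun x y => (x <= y)%O) -> exists x, supremums C x.
  move=> totC; have admC : admissible G (\bigcup_(S in C) aset S).
    apply: admissible_bigcup => [S _|S S' CS CS'].
      by apply/set_mem; apply: asetP.
    by case: (totC S S' CS CS') => /le_admissible_set; [left|right].
  (* The union is already the supremum among all sets, hence also among the admissible ones, being
     admissible itself. *)
  exists (AdmissibleSet (mem_set admC)); split=> [S CS|T ubT].
    by apply/le_admissible_set; apply: bigcup_sup.
  apply/le_admissible_set; apply: bigcup_sub => S CS.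
  by apply/le_admissible_set; apply: ubT.
(* The least element is the supremum of the empty chain, since every [y] bounds [set0] vacuously. *)
split=> //; have [|x [_ lex]] := sup_chain set0; first by [].
by exists x => y; apply: lex.
Qed.
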